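(* Let $G:\mathbb{R}^d\to\mathbb{R}$ be a function for which there exist constants $L,p>0$ and $\alpha\in(0,1]$ such that $$|G(x)-G(y)|\le L(1+|x|^p+|y|^p)|x-y|^{\alpha},\quad x,y\in\mathbb{R}^d,$$ and let $\mathbb{E}[|x_0|^{2p+2}]<\infty$. Then, for each $\xi\in\arg\min_{x\in\mathbb{R}^d}G(x)$, there exists a constant $C>0$, depending only on $p,\alpha,L,\mathbb{E}[|x_0-\xi|^{2+2p}]$ and $|\xi|$, such that for each $\varepsilon\in(0,e^{-1})$ there exists an admissible control $\tilde\theta^\varepsilon\in\Theta$ whose state process $X^{0,x_0;\tilde\theta^\varepsilon}$ satisfies $$0\le\mathbb{E}\left[G(X_1^{0,x_0;\tilde\theta^\varepsilon})+\frac\varepsilon2\int_0^1|\tilde\theta^\varepsilon_t|^2dt\right]-G(\xi)\le C\,\varepsilon\left\{d\ln d+d\ln\left(\frac1\varepsilon\right)\right\}.$$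
   Context: $W=(W_t)_{t\ge0}$ is a standard $d$-dimensional Wiener process and $x_0$ an $\mathbb{R}^d$-valued random variable on a complete filtered probability space $(\Omega,\mathcal{F},(\mathcal{F}_t)_{t\ge 0},\mathbb{P})$; the filtration is generated by $x_0$ and $W$ and augmented by the null sets; $x_0$ is $\mathcal{F}_0$-measurable and independent of $W$. $\Theta$ is the set of admissible controls, i.e. of $(\mathcal{F}_t)$-adapted $\mathbb{R}^d$-valued processes $\theta$ on $[0,1]$ with $\mathbb{E}\big[\big(\int_0^1|\theta_s|ds\big)^2\big]<\infty$. For $\theta\in\Theta$, $X_t^{0,x_0;\theta}=x_0+\int_0^t\theta_s\,ds+W_t$, $t\in[0,1]$. *)

(* Defs.v *)
From HB Require Import structures.
From mathcomp Require Import all_boot all_order all_algebra.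
From mathcomp Require Import all_classical all_reals all_analysis.
Set Implicit Arguments.
Unset Strict Implicit.
Unset Printing Implicit Defensive.
Import Order.TTheory GRing.Theory Num.Theory.
Import numFieldNormedType.Exports.
Local Open Scope classical_set_scope.
Local Open Scope ring_scope.

(* The library's norm on 'rV[R]_d is the sup norm, hence this definition. *)
Definition enorm (R : realType) (d : nat) (x : 'rV[R]_d) : R :=
  Num.sqrt (\sum_(i < d) x 0 i ^+ 2).

(* The preimages under Y of measurable coordinate cylinders: they generate the
   sigma-algebra sigma(Y), since the Borel sigma-algebra of R^d is the product
   one.  An R^d-valued Y is measurable with respect to a sigma-algebra F
   exactly when [coord_preimages Y `<=` F]. *)
Definition coord_preimages (R : realType) (d : nat) (T : Type)
    (Y : T -> 'rV[R]_d) : set_system T :=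
  \bigcup_(i in [set: 'I_d])
    preimage_set_system setT (fun w => Y w 0 i) measurable.

Definition sigma_rv (R : realType) (d : nat) (T : Type)
    (Y : T -> 'rV[R]_d) : set_system T :=
  <<s coord_preimages Y >>.

Definition sigma_process (R : realType) (d : nat) (T : Type) (I : set R)
    (Y : R -> T -> 'rV[R]_d) : set_system T :=
  <<s \bigcup_(t in I) coord_preimages (Y t) >>.

Definition independent_systems (R : realType) (disp : measure_display)
    (T : measurableType disp) (P : probability T R) (F G : set_system T) :
    Prop :=
  forall A B : set T, F A -> G B -> (P (A `&` B) = P A * P B)%E.

(* W t is only meaningful for t >= 0.  The second argument of [normal_prob] is
   the standard deviation. *)
Record is_wiener (R : realType) (disp : measure_display)
    (T : measurableType disp) (P : probability T R) (d : nat)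
    (W : R -> T -> 'rV[R]_d) : Prop := IsWiener {
  wiener_measurable : forall t, 0 <= t -> coord_preimages (W t) `<=` measurable;
  wiener_start : {ae P, forall w, W 0 w = 0};
  wiener_continuous :
    {ae P, forall w, {within `[0, +oo[, continuous (fun t => W t w)}};
  wiener_independent_increments : forall s t, 0 <= s -> s < t ->
    independent_systems P (sigma_process `[0, s] W)
                          (sigma_rv (fun w => W t w - W s w));
  wiener_gaussian_increments : forall s t, 0 <= s -> s < t ->
    forall B : 'I_d -> set R, (forall i, measurable (B i)) ->
    P [set w | forall i, B i ((W t w - W s w) 0 i)] =
    (\prod_(i < d) normal_prob 0 (Num.sqrt (t - s)) (B i))%E
}.

Definition filtration (R : realType) (disp : measure_display)
    (T : measurableType disp) (P : probability T R) (d : nat)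
    (x0 : T -> 'rV[R]_d) (W : R -> T -> 'rV[R]_d) (t : R) : set_system T :=
  <<s coord_preimages x0 `|` \bigcup_(s in `[0, t]) coord_preimages (W s)
      `|` P.-negligible >>.

(* A process theta on [0, 1] is read as jointly measurable, so that the time
   integrals of its paths are random variables. *)
Record admissible (R : realType) (disp : measure_display)
    (T : measurableType disp) (P : probability T R) (d : nat)
    (x0 : T -> 'rV[R]_d) (W theta : R -> T -> 'rV[R]_d) : Prop := Admissible {
  admissible_measurable : forall i : 'I_d,
    measurable_fun ([set: T] `*` (`[0, 1] : set R))
      (fun z : T * R => theta z.2 z.1 0 i);
  admissible_adapted : forall t, 0 <= t <= 1 ->
    coord_preimages (theta t) `<=` filtration P x0 W t;
  admissible_integrable :
    (\int[P]_w
       (\int[lebesgue_measure]_(s in `[0%R, 1%R]) (enorm (theta s w))%:E) ^+ 2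
     < +oo)%E
}.

Definition state (R : realType) (T : Type) (d : nat)
    (x0 : T -> 'rV[R]_d) (W theta : R -> T -> 'rV[R]_d) (t : R) (w : T) :
    'rV[R]_d :=
  x0 w + \row_i (\int[lebesgue_measure]_(s in `[0, t]) theta s w 0 i) + W t w.

(* E[G(X_1) + eps/2 * int_0^1 |theta_t|^2 dt].  The running cost may be
   infinite, so the integrand is extended-real valued. *)
Definition cost (R : realType) (disp : measure_display)
    (T : measurableType disp) (P : probability T R) (d : nat)
    (G : 'rV[R]_d -> R) (x0 : T -> 'rV[R]_d) (W : R -> T -> 'rV[R]_d)
    (eps : R) (theta : R -> T -> 'rV[R]_d) : \bar R :=
  (\int[P]_w
     ((G (state x0 W theta 1 w))%:E
      + (eps / 2)%:E * \int[lebesgue_measure]_(t in `[0%R, 1%R])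
                          (enorm (theta t w) ^+ 2)%:E))%E.

(* Main.v *)
(* A piecewise constant control suffices. Put tau_k = 1 - 2^(-k) and, on
   [tau_k, tau_(k+1)[ with k <= n, let theta be the constant that would bring
   the state to xi at time tau_(k+1) in the absence of noise. Then
   X_(tau_(k+1)) - xi is just the Wiener increment over that interval; in
   particular X_1 - xi = W_1 - W_(tau_n) is centred Gaussian with variance
   2^(-n) per coordinate, whatever x0 is. Each interval with k >= 1 costs O(d),
   since an increment of variance 2^(-k) is cancelled within time 2^(-k-1), and
   the first one costs 2 E|x0 - xi|^2. Choosing n of order ln d + ln (1/eps)
   makes 2^(-n) <= eps^(2/alpha) / d^2, so that E G(X_1) - G xi = O(eps) and the
   running cost is O(eps d n). *)
Require Import Defs.
From HB Require Import structures.
From mathcomp Require Import all_boot all_order all_algebra.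
From mathcomp Require Import all_classical all_reals all_analysis.
From mathcomp Require Import measurable_realfun ring lra.
Import Order.TTheory GRing.Theory Num.Theory.
Import numFieldNormedType.Exports.
Local Open Scope classical_set_scope.
Local Open Scope ring_scope.

Set Implicit Arguments.
Unset Strict Implicit.
Unset Printing Implicit Defensive.

(** * Change of variables and Gaussian moments *)

Section density.
Import HBNNSimple.
Local Open Scope ereal_scope.

(** Transfer to a law with density [h], in three stages: indicators, where it is the hypothesis on
    [P]; simple functions, by linearity; then monotone convergence along [nnsfun_approx]. *)
Lemma ge0_integral_density (R : realType) (disp disp' : measure_display)
    (T : measurableType disp) (U : measurableType disp')
    (P : {measure set T -> \bar R}) (mu : {measure set U -> \bar R})
    (Y : T -> U) (h : U -> R) (f : U -> \bar R) :
  measurable_fun setT Y -> measurable_fun setT h -> (forall x, (0 <= h x)%R) ->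
  (forall A, measurable A -> P (Y @^-1` A) = \int[mu]_(x in A) (h x)%:E) ->
  measurable_fun setT f -> (forall x, 0 <= f x) ->
  \int[P]_w f (Y w) = \int[mu]_x (f x * (h x)%:E).
Proof.
move=> mY mh h0 PY mf f0.
have mhE : measurable_fun setT (fun x => (h x)%:E) by exact/measurable_EFinP.
have mindic A : measurable A -> measurable_fun setT (fun w => \1_A (Y w) : R).
  by move=> mA; apply: (measurableT_comp _ mY); exact: measurable_indic.
have indic_case A : measurable A ->
    \int[P]_w (\1_A (Y w))%:E = \int[mu]_x ((\1_A x)%:E * (h x)%:E).
  move=> mA.
  transitivity (P (Y @^-1` A)).
    rewrite (_ : (fun w => _) = (fun w => (\1_(Y @^-1` A) w)%:E))//.
    by rewrite integral_indic ?setIT// -[X in measurable X]setTI; exact: mY.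
  rewrite PY// integral_mkcond; apply: eq_integral => x _.
  by rewrite patchE indicE; case: (x \in A); rewrite ?mul1e ?mul0e.
have simple_case (g : {nnsfun U >-> R}) :
    \int[P]_w (g (Y w))%:E = \int[mu]_x ((g x)%:E * (h x)%:E).
  have ind0 (r : R) (x : U) : 0 <= (r * \1_(g @^-1` [set r]) x)%:E.
    by rewrite EFinM nnfun_muleindic_ge0.
  under eq_integral do rewrite fimfunE -fsumEFin//.
  rewrite ge0_integral_fsum//; last first.
    move=> r; apply/measurable_EFinP; apply: measurable_funM => //.
    exact: mindic.
  under [RHS]eq_integral.
    move=> x _; rewrite fimfunE -fsumEFin// ge0_mule_fsuml//; over.
  rewrite [RHS]ge0_integral_fsum//; last 2 first.
  - move=> r; apply: emeasurable_funM => //.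
    by apply/measurable_EFinP; exact: measurable_funM.
  - by move=> r x _; rewrite mule_ge0// lee_fin.
  apply: eq_fsbigr => r /set_mem[x _ <-]/=.
  under eq_integral do rewrite EFinM.
  under [RHS]eq_integral do rewrite EFinM -muleA.
  rewrite ge0_integralZl//; last 2 first.
  - by apply/measurable_EFinP; exact: mindic.
  - by rewrite lee_fin.
  rewrite ge0_integralZl//; last 3 first.
  - by apply: emeasurable_funM => //; exact/measurable_EFinP.
  - by move=> y _; rewrite mule_ge0// lee_fin.
  - by rewrite lee_fin.
  by rewrite indic_case.
pose f_ := nnsfun_approx measurableT mf.
have nd_f_ x : {homo (fun n => (f_ n x)%:E) : m n / (m <= n)%N >-> m <= n}.
  by move=> m n mn; rewrite lee_fin; exact/lefP/nd_nnsfun_approx.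
have lim_f_ x : limn (fun n => (f_ n x)%:E) = f x.
  by apply/cvg_lim => //; exact: cvg_nnsfun_approx.
transitivity (limn (fun n => \int[P]_w (f_ n (Y w))%:E)).
  rewrite -monotone_convergence//.
  - by apply: eq_integral => w _; rewrite lim_f_.
  - by move=> n; apply/measurable_EFinP; exact: measurableT_comp.
  - by move=> n w _; rewrite lee_fin.
transitivity (limn (fun n => \int[mu]_x ((f_ n x)%:E * (h x)%:E))).
  by apply: congr_lim; apply/funext => n; rewrite simple_case.
rewrite -monotone_convergence//.
- apply: eq_integral => x _; under eq_fun do rewrite muleC.
  rewrite limeMl//; first by rewrite lim_f_ muleC.
  by apply: ereal_nondecreasing_is_cvgn => m n; exact: nd_f_.
- move=> n; apply: emeasurable_funM => //.
  exact/measurable_EFinP/measurable_funTS.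
- by move=> n x _; rewrite mule_ge0// lee_fin.
- by move=> x _ m n mn; rewrite lee_wpmul2r ?lee_fin//; exact/lefP/nd_nnsfun_approx.
Qed.

End density.

Lemma exprn_le_fact_expR (R : realType) (y : R) (m : nat) :
  0 <= y -> y ^+ m <= m`!%:R * expR y.
Proof.
move=> y0; case: m => [|m].
  by rewrite expr0 fact0 mul1r; have := expR_ge1Dx y; lra.
have := expR_ge1Dxn m y0.
rewrite -ler_pdivrMl ?ltr0n ?fact_gt0// => H.
by rewrite mulrC; lra.
Qed.

(** An upper bound for the 2m-th moment of the standard normal law, not its exact value. The 2 is
    the ratio of the peaks of the densities with deviations s and 2s; the rest comes from y^m <= m!
    e^y at y = x^2/(4s^2). *)
Definition normal_moment_cst (R : realType) (m : nat) : R := 2 * 4 ^+ m * m`!%:R.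

Lemma normal_moment_cst_ge0 (R : realType) (m : nat) : 0 <= normal_moment_cst R m.
Proof. by rewrite /normal_moment_cst !mulr_ge0// exprn_ge0. Qed.

(* Half of the exponent x^2/(2s^2) pays for the factor x^(2m); what remains is
   dominated by the density with standard deviation 2s. *)
Lemma moment_normal_pdf_le (R : realType) (s x : R) (m : nat) : 0 < s ->
  x ^+ (2 * m) * normal_pdf 0 s x <=
  normal_moment_cst R m * s ^+ (2 * m) * normal_pdf 0 (2 * s) x.
Proof.
move=> s0; have ns0 : s != 0 by rewrite gt_eqF.
have n2s0 : 2 * s != 0 by rewrite gt_eqF// mulr_gt0.
rewrite !normal_pdfE// /normal_fun subr0 /normal_moment_cst.
have -> : normal_peak s = 2 * normal_peak (2 * s).
  rewrite /normal_peak.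
  rewrite (_ : (2 * s) ^+ 2 * pi *+ 2 = 2 ^+ 2 * (s ^+ 2 * pi *+ 2)); last by ring.
  rewrite sqrtrM ?sqrtr_sqr ?normr_nat ?exprn_ge0// invfM mulrA mulfV ?mul1r//.
set y := x ^+ 2 / (4 * s ^+ 2).
have y0 : 0 <= y by apply: divr_ge0; [|apply: mulr_ge0 => //]; exact: sqr_ge0.
have -> : - x ^+ 2 / (s ^+ 2 *+ 2) = - y - y by rewrite /y; field.
have -> : - x ^+ 2 / ((2 * s) ^+ 2 *+ 2) = - (y / 2) by rewrite /y; field.
have -> : x ^+ (2 * m) = (4 * s ^+ 2) ^+ m * y ^+ m.
  by rewrite -exprMn exprM; congr (_ ^+ _); rewrite /y; field.
have e1 : y ^+ m * expR (- y - y) <= m`!%:R * expR (- (y / 2)).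
  rewrite (@le_trans _ _ (m`!%:R * expR y * expR (- y - y)))//.
    by rewrite ler_wpM2r ?expR_ge0// exprn_le_fact_expR.
  by rewrite -mulrA -expRD ler_wpM2l// ler_expR; lra.
rewrite [leLHS](_ : _ = (4 ^+ m * s ^+ (2 * m) * 2 * normal_peak (2 * s)) *
    (y ^+ m * expR (- y - y))); last by rewrite exprMn exprM; ring.
rewrite [leRHS](_ : _ = (4 ^+ m * s ^+ (2 * m) * 2 * normal_peak (2 * s)) *
    (m`!%:R * expR (- (y / 2)))); last by ring.
by rewrite ler_wpM2l// !mulr_ge0 ?exprn_ge0 ?normal_peak_ge0// ltW.
Qed.

Lemma normal_moment_le (R : realType) (disp : measure_display)
    (T : measurableType disp) (P : probability T R) (Y : T -> R) (s : R)
    (m : nat) :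
  0 < s -> measurable_fun setT Y ->
  (forall A, measurable A -> P (Y @^-1` A) = normal_prob 0 s A) ->
  (\int[P]_w (Y w ^+ (2 * m))%:E <=
   (normal_moment_cst R m * s ^+ (2 * m))%:E)%E.
Proof.
move=> s0 mY PY.
have mX : measurable_fun setT (fun x : R => (x ^+ (2 * m))%:E).
  by apply/measurable_EFinP; exact: measurable_funX.
have X0 (x : R) : (0 <= (x ^+ (2 * m))%:E)%E.
  by rewrite lee_fin exprM exprn_ge0// sqr_ge0.
have mpdf t : measurable_fun setT (fun x => (normal_pdf (0 : R) t x)%:E).
  by apply/measurable_EFinP; exact: measurable_normal_pdf.
rewrite (@ge0_integral_density _ _ _ _ _ P lebesgue_measure Y (normal_pdf 0 s)
  (fun x => (x ^+ (2 * m))%:E) mY (measurable_normal_pdf _ _)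
  (normal_pdf_ge0 _ _) PY mX X0).
rewrite [leRHS](_ : _ = \int[lebesgue_measure]_x
  ((normal_moment_cst R m * s ^+ (2 * m))%:E *
     (normal_pdf 0 (2 * s) x)%:E))%E.
  apply: ge0_le_integral => //.
  - by move=> x _; rewrite mule_ge0// lee_fin normal_pdf_ge0.
  - exact: emeasurable_funM mX (mpdf s).
  - exact: emeasurable_funM (measurable_cst _) (mpdf (2 * s)).
  - by move=> x _; rewrite -!EFinM lee_fin moment_normal_pdf_le.
rewrite ge0_integralZl_EFin// ?integral_normal_pdf ?mule1//.
- by move=> x _; rewrite lee_fin normal_pdf_ge0.
- exact: mpdf.
- by rewrite mulr_ge0 ?normal_moment_cst_ge0// exprM exprn_ge0// sqr_ge0.
Qed.

(** * Coordinates of Wiener increments *)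

Lemma wiener_increment_coord (R : realType) (disp : measure_display)
    (T : measurableType disp) (P : probability T R) (d : nat)
    (W : R -> T -> 'rV[R]_d) (s t : R) (i : 'I_d) (A : set R) :
  is_wiener P W -> 0 <= s -> s < t -> measurable A ->
  P ((fun w => (W t w - W s w) 0 i) @^-1` A) =
  normal_prob 0 (Num.sqrt (t - s)) A.
Proof.
move=> wW s0 st mA.
(* Leaving every coordinate but the i-th unconstrained turns the product law into its i-th
   marginal. *)
pose B j := if j == i then A else [set: R].
have mB j : measurable (B j) by rewrite /B; case: ifP.
have := wiener_gaussian_increments wW s0 st mB.
rewrite (bigD1 i)//= big1 ?mule1; last first.
  move=> j ji; rewrite /B (negbTE ji).
  exact: (@probability_setT _ _ _ (normal_prob 0 (Num.sqrt (t - s)))).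
rewrite {2}/B eqxx => <-; congr (P _); apply/seteqP; split => w /=.
  by move=> Aw j; rewrite /B; case: eqP => [->|].
by move=> /(_ i); rewrite /B eqxx.
Qed.

Lemma coord_preimages_measurable (R : realType) (disp : measure_display)
    (T : measurableType disp) (d : nat) (Y : T -> 'rV[R]_d) :
  coord_preimages Y `<=` measurable <->
  forall i, measurable_fun setT (fun w => Y w 0 i).
Proof.
split=> [mY i _ A mA|mY A [i _ [B mB <-]]]; last exact: mY.
by apply: mY; exists i => //; exists A.
Qed.

Lemma measurable_wiener_increment (R : realType) (disp : measure_display)
    (T : measurableType disp) (P : probability T R) (d : nat)
    (W : R -> T -> 'rV[R]_d) (s t : R) (i : 'I_d) :
  is_wiener P W -> 0 <= s -> 0 <= t ->
  measurable_fun setT (fun w => (W t w - W s w) 0 i).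
Proof.
move=> wW s0 t0.
have mW u : 0 <= u -> measurable_fun setT (fun w => W u w 0 i).
  by move=> u0; have /coord_preimages_measurable := wiener_measurable wW u0; apply.
under eq_fun do rewrite !mxE.
by apply: measurable_funB; exact: mW.
Qed.

(** The sum is at most n times its largest term, and the k-th power of that term is one of the
    summands on the right. *)
Lemma expr_sum_le (R : realType) (n k : nat) (a : 'I_n -> R) :
  (0 < n)%N -> (forall i, 0 <= a i) ->
  (\sum_i a i) ^+ k <= n%:R ^+ k * \sum_i a i ^+ k.
Proof.
case: n a => // n a _ a0.
have [j _ jmax] := @arg_maxP _ _ _ ord0 xpredT a isT.
have sum_le : \sum_i a i <= n.+1%:R * a j.
  rewrite mulr_natl -[X in _ *+ X](card_ord n.+1) -sumr_const.
  by apply: ler_sum => i _; exact: jmax.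
rewrite (@le_trans _ _ (n.+1%:R ^+ k * a j ^+ k))//.
  by rewrite -exprMn; apply: lerXn2r => //; rewrite nnegrE ?sumr_ge0// mulr_ge0.
rewrite ler_wpM2l ?exprn_ge0// (bigD1 j)//= lerDl.
by apply: sumr_ge0 => i _; rewrite exprn_ge0.
Qed.

(** * The Euclidean norm *)

Section enorm_theory.
Variables (R : realType) (d : nat).
Implicit Types x y : 'rV[R]_d.

Lemma enorm_ge0 x : 0 <= enorm x. Proof. exact: sqrtr_ge0. Qed.

Lemma sqr_enorm x : enorm x ^+ 2 = \sum_(i < d) x 0 i ^+ 2.
Proof. by rewrite sqr_sqrtr// sumr_ge0// => i _; exact: sqr_ge0. Qed.

Lemma enorm0 : enorm (0 : 'rV[R]_d) = 0.
Proof. by rewrite /enorm big1 ?sqrtr0// => i _; rewrite mxE expr0n. Qed.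

Lemma enormZ (a : R) x : enorm (a *: x) = `|a| * enorm x.
Proof.
rewrite /enorm -sqrtr_sqr -sqrtrM ?sqr_ge0// mulr_sumr.
by congr Num.sqrt; apply: eq_bigr => i _; rewrite mxE exprMn.
Qed.

Lemma enormN x : enorm (- x) = enorm x.
Proof. by rewrite -scaleN1r enormZ normrN normr1 mul1r. Qed.

(** Stands in for the triangle inequality: (a+b)^2 <= 2a^2 + 2b^2 in each coordinate. The maximum
    suits real powers, since the power of a maximum is at most the sum of the powers. *)
Lemma enormD_le_max x y : enorm (x + y) <= 2 * Num.max (enorm x) (enorm y).
Proof.
set m := Num.max _ _.
have xm : enorm x <= m by rewrite le_max lexx.
have ym : enorm y <= m by rewrite le_max lexx orbT.
have m0 : 0 <= m by rewrite (le_trans (enorm_ge0 x)).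
rewrite -(@ler_pXn2r _ 2)// ?nnegrE ?enorm_ge0 ?mulr_ge0//.
have x2 : enorm x ^+ 2 <= m ^+ 2 by rewrite lerXn2r ?nnegrE ?enorm_ge0.
have y2 : enorm y ^+ 2 <= m ^+ 2 by rewrite lerXn2r ?nnegrE ?enorm_ge0.
suff : enorm (x + y) ^+ 2 <= 2 * enorm x ^+ 2 + 2 * enorm y ^+ 2.
  by rewrite exprMn; lra.
rewrite !sqr_enorm !mulr_sumr -big_split/=; apply: ler_sum => i _.
by rewrite mxE; have := sqr_ge0 (x 0 i - y 0 i); nra.
Qed.

(** Compares [enorm] with the sup norm, whose balls give the topology of ['rV[R]_d]. *)
Lemma enorm_le_coord x (e : R) : 0 <= e -> (forall i, `|x 0 i| <= e) ->
  enorm x <= d%:R * e.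
Proof.
move=> e0 xe.
rewrite -(@ler_pXn2r _ 2)// ?nnegrE ?enorm_ge0 ?mulr_ge0// sqr_enorm.
apply: (@le_trans _ _ (\sum_(i < d) e ^+ 2)).
  by apply: ler_sum => i _; rewrite -(real_normK (num_real (x 0 i))) lerXn2r ?nnegrE.
rewrite sumr_const card_ord -[leLHS]mulr_natl exprMn ler_wpM2r ?sqr_ge0//.
by rewrite -natrX ler_nat; case: (d) => // n; exact: leq_pmulr.
Qed.

Lemma enorm_expr_le x (m : nat) : (0 < d)%N ->
  enorm x ^+ (2 * m) <= d%:R ^+ m * \sum_(i < d) x 0 i ^+ (2 * m).
Proof.
move=> d0; rewrite exprM sqr_enorm.
under [X in _ * X]eq_bigr do rewrite exprM.
by apply: expr_sum_le => // i; exact: sqr_ge0.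
Qed.

Lemma measurable_enorm (disp : measure_display) (T : measurableType disp)
    (Y : T -> 'rV[R]_d) :
  (forall i, measurable_fun setT (fun w => Y w 0 i)) ->
  measurable_fun setT (fun w => enorm (Y w)).
Proof.
move=> mY.
have -> : (fun w => enorm (Y w)) =
    (fun w => (\sum_(i < d) Y w 0 i ^+ 2) `^ 2^-1).
  by apply/funext => w; rewrite powR12_sqrt// sumr_ge0// => i _; exact: sqr_ge0.
pose f w := \sum_(i < d) Y w 0 i ^+ 2.
rewrite (_ : (fun w => _) = @powR R ^~ 2^-1 \o f)//.
apply: measurableT_comp; first exact: measurable_powR.
by apply: measurable_sum => i; exact: measurable_funX.
Qed.

End enorm_theory.

(** * Continuity of [G] and measurability of [G] along a random vector *)

Section measurability.
Variables (R : realType) (d : nat).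

(** Only the coordinates of X are known to be measurable. The open set where G exceeds a is
    therefore covered by the countably many rational cubes inside it; the preimage of a cube under X
    is a finite intersection of coordinate preimages. *)
Lemma measurable_continuous_rV (disp : measure_display)
    (T : measurableType disp) (G : 'rV[R]_d -> R) (X : T -> 'rV[R]_d) :
  continuous G -> (forall i, measurable_fun setT (fun w => X w 0 i)) ->
  measurable_fun setT (fun w => G (X w)).
Proof.
move=> cG mX.
apply: (measurability _ (RGenOInfty.measurableE R)).
move=> _ [_ [a ->] <-]; rewrite setTI.
pose box (q : 'rV[rat]_d) (k : nat) : set 'rV[R]_d :=
  [set y | forall i, `|ratr (q 0 i) - y 0 i| < k.+1%:R^-1].
pose F (qk : 'rV[rat]_d * nat) : set T := [set w |
  box qk.1 qk.2 `<=` [set y | a < G y] /\ box qk.1 qk.2 (X w)].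
rewrite (_ : _ @^-1` _ = \bigcup_qk F qk).
  apply: countable_bigcupT_measurable => [|[q k]].
    exact: countableP.
  have [qk|nqk] := pselect (box q k `<=` [set y | a < G y]); last first.
    by rewrite (_ : F _ = set0)//; apply/seteqP; split => w // -[/nqk].
  rewrite (_ : F _ = \bigcap_(i in [set: 'I_d])
      ((fun w => X w 0 i) @^-1` (ball (ratr (q 0 i) : R) k.+1%:R^-1))).
    apply: fin_bigcap_measurable => // i _.
    rewrite -[X in measurable X]setTI; apply: mX => //.
    exact: measurable_ball.
  apply/seteqP; split => w /=; first by move=> [_ bX] i _; exact: bX.
  by move=> bX; split=> // i; exact: bX.
apply/seteqP; split => w /=; last first.
  by move=> [[q k] _ [+ bX]] => /(_ _ bX); rewrite /= in_itv/= andbT.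
rewrite in_itv/= andbT => aG.
have : nbhs (X w) [set y | a < G y].
  by apply: (cG (X w) [set z | a < z]); exact: lt_nbhsr.
move=> /nbhs_ballP[e/= e0 eG].
(* In each coordinate, [X w] and a point of the cube are both within 1/(k+1) of the rational centre,
   hence the factor 2. *)
have [k ke] : exists k : nat, 2 * k.+1%:R^-1 < e.
  exists (Num.truncn (2 / e)).
  rewrite ltr_pdivrMr// mulrC -ltr_pdivrMr//.
  by have /andP[] := truncn_itv (divr_ge0 (ler0n R 2) (ltW e0)).
have q_ i : exists q : rat, `|ratr q - X w 0 i| < k.+1%:R^-1.
  have [|q] := @rat_in_itvoo R (X w 0 i - k.+1%:R^-1) (X w 0 i + k.+1%:R^-1).
    by rewrite ltrD2l gtrN// invr_gt0.
  rewrite in_itv/= => /andP[q1 q2]; exists q.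
  by rewrite ltr_distl q1.
have [q qX] := choice q_.
exists (\row_i q i, k) => //; split => [y yq|i /=]; last by rewrite mxE.
apply: eG; split=> // i j; rewrite !ord1; rewrite /ball/=.
have := yq j; rewrite /= mxE => yqj; have := qX j => qXj.
rewrite (le_lt_trans _ ke)// (le_trans (ler_distD (ratr (q j)) _ _))//.
by rewrite distrC mulrDl !mul1r lerD// ltW.
Qed.

(** Near x the growth factor is bounded, so that G is locally Hölder there. This is the source of
    the measurability of G along the state. *)
Lemma hoelder_continuous (L p alpha : R) (G : 'rV[R]_d -> R) :
  0 < L -> 0 < p -> 0 < alpha ->
  (forall x y : 'rV[R]_d, `|G x - G y| <=
     L * (1 + enorm x `^ p + enorm y `^ p) * enorm (x - y) `^ alpha) ->
  continuous G.
Proof.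
move=> L0 p0 a0 hG x.
(* If each coordinate of y is within 1 of that of x, then y - x has norm at most d, whence the bound
   2 max(|x|, d) on the norm of y. *)
pose K := L * (1 + enorm x `^ p + (2 * Num.max (enorm x) d%:R) `^ p).
have K0 : 0 < K by rewrite mulr_gt0// -addrA ltr_pwDl// addr_ge0 ?powR_ge0.
apply/cvgrPdist_lt => [|e e0]; first exact: (nbhs_filter x).
(* Coordinate distances of at most [eta] give a Euclidean distance of at most d times [eta];
   dividing by d+1 makes this strictly less than (e/K)^(1/alpha). *)
pose eta := (e / K) `^ alpha^-1 / d.+1%:R.
have eK0 : 0 < e / K by rewrite divr_gt0.
have eta0 : 0 < eta by rewrite divr_gt0// powR_gt0.
pose de := Num.min 1 eta.
have de0 : 0 < de by rewrite lt_min eta0 ltr01.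
suff : nbhs x [set y | `|G x - G y| < e] by [].
apply/nbhs_ballP; exists de => //= y [_ xy].
have cxy i : `|(x - y) 0 i| <= de.
  by rewrite !mxE; apply/ltW; exact: xy.
have cyx i : `|(y - x) 0 i| <= de.
  by rewrite !mxE distrC; apply/ltW; exact: xy.
have y_le : enorm y <= 2 * Num.max (enorm x) d%:R.
  rewrite -[y in leLHS](subrK x) addrC (le_trans (enormD_le_max _ _))//.
  rewrite ler_pM2l// ge_max !le_max lexx/=.
  apply/orP; right; apply: le_trans (enorm_le_coord (ltW de0) cyx) _.
  by rewrite ler_piMr// ge_min lexx.
have xy_lt : enorm (x - y) < (e / K) `^ alpha^-1.
  rewrite (le_lt_trans (enorm_le_coord (ltW de0) cxy))//.
  rewrite (@le_lt_trans _ _ (d%:R * eta))//.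
    by rewrite ler_wpM2l// ge_min lexx orbT.
  rewrite /eta mulrCA gtr_pMr ?powR_gt0//.
  by rewrite ltr_pdivrMr// mul1r ltr_nat.
apply: le_lt_trans (hG x y) _.
apply: (@le_lt_trans _ _ (K * enorm (x - y) `^ alpha)).
  rewrite ler_wpM2r ?powR_ge0// ler_wpM2l ?(ltW L0)// lerD2l.
  by rewrite ge0_ler_powR ?nnegrE ?enorm_ge0// ?(ltW p0)// (le_trans (enorm_ge0 y)).
rewrite mulrC -ltr_pdivlMr//.
rewrite (_ : e / K = ((e / K) `^ alpha^-1) `^ alpha).
  by rewrite gt0_ltr_powR// ?nnegrE ?enorm_ge0 ?powR_ge0.
by rewrite -powRrM mulVf ?gt_eqF// powRr1// ltW.
Qed.

End measurability.

(** * Piecewise constant processes: time integrals, measurability, adaptedness *)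

Definition step_process (R : realType) (d : nat) (tau : nat -> R) (n : nat)
    (A : nat -> 'rV[R]_d) (t : R) : 'rV[R]_d :=
  \sum_(k < n) \1_`[tau k, tau k.+1[%classic t *: A k.

Section step_process_theory.
Variables (R : realType) (d : nat) (tau : nat -> R) (n : nat).
Hypothesis tau_homo : {homo tau : i j / (i <= j)%N >-> i <= j}.

(** The half-open intervals are disjoint, so at most one term survives at time t; [phi 0 = 0] takes
    care of the times that lie in none. *)
Lemma step_process_comp (A : nat -> 'rV[R]_d) (phi : 'rV[R]_d -> R) (t : R) :
  phi 0 = 0 ->
  phi (step_process tau n A t) =
  \sum_(k < n) \1_`[tau k, tau k.+1[%classic t * phi (A k).
Proof.
move=> phi0; rewrite /step_process.
have [[k tk]|nk] := pselect (exists k : 'I_n, `[tau k, tau k.+1[%classic t).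
  have tj (j : 'I_n) : j != k -> \1_`[tau j, tau j.+1[%classic t = 0 :> R.
    move=> jk; rewrite indicE; case: (boolP (t \in _)) => //; rewrite inE/= => tj.
    move: tk tj; rewrite /= !in_itv/= => /andP[kt tk] /andP[jt tj].
    case: (ltngtP j k) => [jk'|kj|/val_inj jk']; last by rewrite jk' eqxx in jk.
    - by have := lt_le_trans tj (le_trans (tau_homo jk') kt); rewrite ltxx.
    - by have := lt_le_trans tk (le_trans (tau_homo kj) jt); rewrite ltxx.
  have tk1 : \1_`[tau k, tau k.+1[%classic t = 1 :> R.
    by rewrite indicE mem_set.
  rewrite (bigD1 k)//= [in RHS](bigD1 k)//= tk1 scale1r mul1r.
  rewrite big1 ?addr0; last by move=> j /tj ->; rewrite scale0r.
  by rewrite big1 ?addr0// => j /tj ->; rewrite mul0r.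
have t0 (k : 'I_n) : \1_`[tau k, tau k.+1[%classic t = 0 :> R.
  by rewrite indicE memNset// => tk; apply: nk; exists k.
by rewrite !big1// => k _; rewrite t0 ?scale0r ?mul0r.
Qed.

Hypotheses (tau_ge0 : 0 <= tau 0%N) (tau_le1 : tau n <= 1).

Lemma integral_step (a : nat -> R) :
  (\int[lebesgue_measure]_(t in `[0%R, 1%R])
     (\sum_(k < n) \1_`[tau k, tau k.+1[%classic t * a k)%:E =
   (\sum_(k < n) (tau k.+1 - tau k) * a k)%:E)%E.
Proof.
under eq_integral do rewrite -sumEFin.
have int1 (k : 'I_n) : lebesgue_measure.-integrable `[(0:R), 1]%classic
    (fun t => (\1_`[tau k, tau k.+1[%classic t)%:E).
  by apply: (@integrableS _ _ _ _ setT) => //; exact: integrable_indic_itv.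
have int2 (k : 'I_n) : lebesgue_measure.-integrable `[(0:R), 1]%classic
    (fun t => (\1_`[tau k, tau k.+1[%classic t * a k)%:E).
  rewrite (_ : (fun _ => _) = (fun t =>
      (a k)%:E * (\1_`[tau k, tau k.+1[%classic t)%:E)%E).
    exact: integrableZl.
  by apply/funext => t; rewrite mulrC EFinM.
rewrite integral_sum// -sumEFin; apply: eq_bigr => k _.
under eq_integral do rewrite mulrC EFinM.
rewrite integralZl// integral_indic//.
have muI : lebesgue_measure (`[tau k, tau k.+1[%classic : set R) =
    (tau k.+1 - tau k)%:E.
  rewrite lebesgue_measure_itv/= lte_fin; case: ltP => [_|kk].
    by rewrite -EFinB.
  suff -> : tau k.+1 = tau k by rewrite subrr.
  by apply/eqP; rewrite eq_le kk tau_homo.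
transitivity ((a k)%:E * (tau k.+1 - tau k)%:E)%E; last by rewrite -EFinM mulrC.
congr (_ * _)%E; rewrite -muI; congr (lebesgue_measure _).
apply/setIidPl => t /=; rewrite !in_itv/= => /andP[kt tk].
rewrite (le_trans tau_ge0) ?(le_trans _ kt) ?tau_homo//=.
by rewrite (le_trans (ltW tk))// (le_trans _ tau_le1)// tau_homo.
Qed.

Lemma measurable_step_process (disp : measure_display)
    (T : measurableType disp) (A : nat -> T -> 'rV[R]_d) (i : 'I_d) :
  (forall k, measurable_fun setT (fun w => A k w 0 i)) ->
  measurable_fun setT
    (fun z : T * R => step_process tau n (A ^~ z.1) z.2 0 i).
Proof.
move=> mA; under eq_fun do rewrite summxE.
apply: measurable_sum => k; under eq_fun do rewrite mxE.
apply: measurable_funM.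
  by apply: (measurableT_comp _ measurable_snd); exact: measurable_indic.
by apply: (measurableT_comp (mA k)); exact: measurable_fst.
Qed.

End step_process_theory.

Section adapted.
Variables (R : realType) (disp : measure_display) (T : measurableType disp).
Variables (P : probability T R) (d : nat) (x0 : T -> 'rV[R]_d).
Variable (W : R -> T -> 'rV[R]_d).

(** The hypothesis says that [A k] is determined by [x0] and the path up to [tau k], phrased through
    an arbitrary generating family. At time t the k-th term either vanishes or has [tau k <= t], and
    then the generators of the filtration at t qualify. *)
Lemma adapted_step_process (tau : nat -> R) (n : nat)
    (A : nat -> T -> 'rV[R]_d) (t : R) :
  (forall k (G : set_system T), coord_preimages x0 `<=` <<s G >> ->
     (forall s, 0 <= s <= tau k -> coord_preimages (W s) `<=` <<s G >>) ->
     coord_preimages (A k) `<=` <<s G >>) ->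
  coord_preimages (fun w => step_process tau n (A ^~ w) t)
    `<=` filtration P x0 W t.
Proof.
move=> adA; rewrite /filtration; set G := (X in <<s X >>).
(* With the generated sigma-algebra as the measurable structure of the space, adaptedness becomes
   measurability of a sum of products. *)
pose T' := g_sigma_algebraType G.
have mG (Y : T -> 'rV[R]_d) : coord_preimages Y `<=` <<s G >> ->
    forall i, measurable_fun setT (fun w : T' => Y w 0 i).
  move=> YG i _ B mB; apply: YG; exists i => //; exists B => //.
suff mS i : measurable_fun setT
    (fun w : T' => step_process tau n (A ^~ w) t 0 i).
  by move=> B [i _ [C mC <-]]; apply: mS.
under eq_fun do rewrite summxE.
apply: measurable_sum => k; under eq_fun do rewrite mxE.
rewrite indicE.
have [/set_mem/=|_] := boolP (t \in `[tau k, tau k.+1[%classic); last first.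
  by under eq_fun do rewrite mul0r; exact: measurable_cst.
rewrite in_itv/= => /andP[kt _]; apply: measurable_funM => //.
apply: mG; apply: adA.
  by move=> B x0B; apply: sub_sigma_algebra; left; left.
move=> s /andP[s0 sk] B WB; apply: sub_sigma_algebra; left; right.
by exists s => //=; rewrite in_itv/= s0 (le_trans sk).
Qed.
End adapted.

(** * Bounds on means of nonnegative random variables *)

(** Measurability and sign travel with the bound, so that moment estimates can be added, scaled and
    compared without further side conditions on integrals. *)
Definition mean_le (R : realType) (disp : measure_display)
    (T : measurableType disp) (P : probability T R) (f : T -> R) (c : R) :=
  [/\ measurable_fun setT f, forall w, 0 <= f w &
      (\int[P]_w (f w)%:E <= c%:E)%E].

Section mean_le_theory.
Variables (R : realType) (disp : measure_display) (T : measurableType disp).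
Variable P : probability T R.
Implicit Types f g : T -> R.

Lemma mean_le_cst (c : R) : 0 <= c -> mean_le P (fun=> c) c.
Proof.
by move=> c0; split => //; rewrite integral_cst//= probability_setT mule1.
Qed.

Lemma mean_leD f g c c' : mean_le P f c -> mean_le P g c' ->
  mean_le P (fun w => f w + g w) (c + c').
Proof.
move=> [mf f0 fc] [mg g0 gc]; split; first exact: measurable_funD.
  by move=> w; rewrite addr_ge0.
under eq_integral do rewrite EFinD.
rewrite ge0_integralD// ?EFinD ?leeD//.
- by move=> w _; rewrite lee_fin.
- exact/measurable_EFinP.
- by move=> w _; rewrite lee_fin.
- exact/measurable_EFinP.
Qed.

Lemma mean_leZ (a : R) f c : 0 <= a -> mean_le P f c ->
  mean_le P (fun w => a * f w) (a * c).
Proof.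
move=> a0 [mf f0 fc]; split; first exact: measurable_funM.
  by move=> w; rewrite mulr_ge0.
under eq_integral do rewrite EFinM.
rewrite ge0_integralZl_EFin//; first by rewrite EFinM lee_wpmul2l// lee_fin.
- by move=> w _; rewrite lee_fin.
- exact/measurable_EFinP.
Qed.

Lemma mean_le_sum (n : nat) (f : 'I_n -> T -> R) (c : 'I_n -> R) :
  (forall i, mean_le P (f i) (c i)) ->
  mean_le P (fun w => \sum_i f i w) (\sum_i c i).
Proof.
elim: n f c => [|n ih] f c fc.
  rewrite big_ord0; under eq_fun do rewrite big_ord0.
  exact: mean_le_cst.
rewrite big_ord_recl; under eq_fun do rewrite big_ord_recl.
by apply: mean_leD => //; exact: ih.
Qed.

Lemma mean_le_trans f c c' : c <= c' -> mean_le P f c -> mean_le P f c'.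
Proof.
by move=> cc' [mf f0 fc]; split => //; rewrite (le_trans fc)// lee_fin.
Qed.

Lemma mean_le_dom f g c : measurable_fun setT f -> (forall w, 0 <= f w <= g w) ->
  mean_le P g c -> mean_le P f c.
Proof.
move=> mf fg [mg g0 gc]; split => //; first by move=> w; have /andP[] := fg w.
apply: le_trans gc; apply: ge0_le_integral => //.
- by move=> w _; rewrite lee_fin; have /andP[] := fg w.
- exact/measurable_EFinP.
- exact/measurable_EFinP.
- by move=> w _; rewrite lee_fin; have /andP[] := fg w.
Qed.

Lemma mean_le_ae f g c : measurable_fun setT f -> (forall w, 0 <= f w) ->
  {ae P, forall w, f w = g w} -> mean_le P g c -> mean_le P f c.
Proof.
move=> mf f0 fg [mg g0 gc]; split => //; apply: le_trans gc.
rewrite le_eqVlt; apply/orP; left; apply/eqP.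
apply: ge0_ae_eq_integral => //.
- exact/measurable_EFinP.
- exact/measurable_EFinP.
- by move=> w _; rewrite lee_fin.
- by move=> w _; rewrite lee_fin.
- by apply: filterS fg => w -> _.
Qed.

Lemma mean_le_integrable f c : mean_le P f c ->
  P.-integrable setT (fun w => (f w)%:E).
Proof.
move=> [mf f0 fc]; apply/integrableP; split; first exact/measurable_EFinP.
under eq_integral do rewrite gee0_abs ?lee_fin//.
exact: le_lt_trans fc (ltry _).
Qed.

(** Yields both final inequalities at once, with [a] the minimum of G and [f] the terminal excess
    plus the running cost. *)
Lemma integral_shift_mean_le (a : R) f c : mean_le P f c ->
  (0 <= \int[P]_w (a + f w)%:E - a%:E <= c%:E)%E.
Proof.
move=> fc; have [mf f0 fc'] := fc.
under eq_integral do rewrite EFinD.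
rewrite integralD//; last exact: mean_le_integrable fc.
  have -> : (\int[P]_w a%:E)%E = a%:E.
    by rewrite integral_cst//= probability_setT mule1.
  rewrite addeAC subee// add0e fc' andbT.
  by apply: integral_ge0 => w _; rewrite lee_fin.
exact: finite_measure_integrable_cst.
Qed.

End mean_le_theory.

(** * Elementary inequalities and growth of [G] around the minimiser *)

Section powR_inequalities.
Variable R : realType.

(** Let l = eps^(1/alpha). For u <= l the left side is at most eps; for u > l it equals eps
    (u/l)^alpha, and the exponent may be raised to 2 because u/l > 1. Thus a second moment of order
    l^2 makes the mean O(eps). *)
Lemma powR_le_quadratic (alpha eps u : R) : 0 < alpha <= 2 -> 0 < eps ->
  0 <= u -> u `^ alpha <= eps + eps / eps `^ (2 / alpha) * u ^+ 2.
Proof.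
move=> /andP[a0 a2] e0 u0.
have [ul|lu] := leP u (eps `^ alpha^-1).
  rewrite (@le_trans _ _ eps)//.
    rewrite -[leRHS](powRr1 (ltW e0)) -(mulVf (lt0r_neq0 a0)) powRrM.
    by rewrite ge0_ler_powR ?nnegrE ?powR_ge0// ltW.
  by rewrite lerDl mulr_ge0 ?sqr_ge0// divr_ge0 ?powR_ge0// ltW.
set l := eps `^ alpha^-1 in lu *.
have l0 : 0 < l by rewrite powR_gt0.
have le : l `^ alpha = eps.
  by rewrite -powRrM mulVf ?gt_eqF// powRr1// ltW.
have l2 : eps `^ (2 / alpha) = l ^+ 2.
  by rewrite mulrC powRrM powR_mulrn ?powR_ge0.
rewrite l2 -[u in leLHS](@mulfVK _ l) ?gt_eqF//.
rewrite powRM ?divr_ge0 ?(ltW l0)// le.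
rewrite (@le_trans _ _ ((u / l) ^+ 2 * eps))//.
  rewrite ler_wpM2r ?(ltW e0)// -powR_mulrn ?divr_ge0 ?(ltW l0)//.
  by rewrite ler_powR// ler_pdivlMr// mul1r ltW.
rewrite ler_wpDl// ?(ltW e0)// expr_div_n.
by rewrite le_eqVlt; apply/orP; left; apply/eqP; field; rewrite gt_eqF.
Qed.

(** For u <= 1 drop the factor u^p; for u > 1 raise the exponent p + alpha to the even integer 2m,
    for which Gaussian moments are available. *)
Lemma powRM_le_sum (p alpha u : R) (m : nat) : 0 < p -> 0 < alpha ->
  p + alpha <= (2 * m)%:R -> 0 <= u ->
  u `^ p * u `^ alpha <= u `^ alpha + u ^+ (2 * m).
Proof.
move=> p0 a0 pam u0; have [u1|u1] := leP u 1.
  rewrite (@le_trans _ _ (u `^ alpha))//; last by rewrite lerDl exprn_ge0.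
  rewrite ler_piMl ?powR_ge0// [leRHS](_ : _ = 1 `^ p); last by rewrite powR1.
  by rewrite ge0_ler_powR ?nnegrE// ltW.
rewrite -powRD; last by rewrite (gt_eqF (lt_trans ltr01 u1)) implybT.
rewrite (@le_trans _ _ (u ^+ (2 * m)))//; last by rewrite lerDr powR_ge0.
by rewrite -powR_mulrn// ler_powR// ltW.
Qed.

End powR_inequalities.

Definition excess_cst (R : realType) (p L r : R) : R :=
  L * (1 + r `^ p + 2 `^ p * r `^ p + 2 `^ p).

(** By |xi+y|^p <= 2^p (|xi|^p + |y|^p), the growth factor splits into a part depending on |xi| only
    and 2^p |y|^p; the latter times |y|^alpha is handled by [powRM_le_sum]. The constant is free of
    d. *)
Lemma excess_le (R : realType) (d : nat) (p alpha L : R) (m : nat)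
    (G : 'rV[R]_d -> R) (xi y : 'rV[R]_d) :
  0 < p -> 0 < L -> 0 < alpha -> p + alpha <= (2 * m)%:R ->
  (forall x y : 'rV[R]_d, `|G x - G y| <=
     L * (1 + enorm x `^ p + enorm y `^ p) * enorm (x - y) `^ alpha) ->
  G (xi + y) - G xi <= excess_cst p L (enorm xi) *
     (enorm y `^ alpha + enorm y ^+ (2 * m)).
Proof.
move=> p0 L0 a0 pam hG; apply: le_trans (ler_norm _) _.
apply: le_trans (hG _ _) _; rewrite (addrC xi y) addrK.
set u := enorm y; set r := enorm xi.
have u0 : 0 <= u := enorm_ge0 y; have r0 : 0 <= r := enorm_ge0 xi.
have ury : enorm (y + xi) `^ p <= 2 `^ p * (r `^ p + u `^ p).
  rewrite (@le_trans _ _ ((2 * Num.max u r) `^ p))//.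
    rewrite ge0_ler_powR ?nnegrE ?enorm_ge0 ?mulr_ge0 ?le_max ?u0 ?(ltW p0)//.
    exact: enormD_le_max.
  rewrite powRM ?le_max ?u0// ler_wpM2l ?powR_ge0//.
  by case: (leP u r) => _; [rewrite lerDl|rewrite lerDr]; exact: powR_ge0.
have := powRM_le_sum p0 a0 pam u0.
rewrite /excess_cst -/r -!mulrA ler_pM2l//.
have := powR_ge0 u alpha; have := exprn_ge0 (2 * m) u0.
have := powR_ge0 r p; have := powR_ge0 (2 : R) p; have := powR_ge0 u p.
move: ury; move: (enorm (y + xi) `^ p) (u `^ alpha) (u ^+ (2 * m)) => Z ua um.
move: (u `^ p) (r `^ p) (2 `^ p) => up rp tp ury up0 tp0 rp0 um0 ua0 upa.
have H1 : Z * ua <= tp * (rp + up) * ua by rewrite ler_wpM2r.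
have H2 : tp * (up * ua) <= tp * (ua + um) by rewrite ler_wpM2l.
have H3 : 0 <= tp * rp * um by rewrite !mulr_ge0.
have H4 : 0 <= rp * um by rewrite !mulr_ge0.
by lra.
Qed.

(** * Moments of Wiener increments *)

Section wiener_moments.
Variables (R : realType) (disp : measure_display) (T : measurableType disp).
Variables (P : probability T R) (d : nat) (W : R -> T -> 'rV[R]_d) (s t : R).
Hypotheses (wW : is_wiener P W) (s_ge0 : 0 <= s) (st : s < t).

Lemma wiener_coord_moment (m : nat) :
  mean_le P (fun w => \sum_(i < d) (W t w - W s w) 0 i ^+ (2 * m))
    (d%:R * (normal_moment_cst R m * (t - s) ^+ m)).
Proof.
have ts0 : 0 < t - s by rewrite subr_gt0.
rewrite mulr_natl -[X in _ *+ X](card_ord d) -sumr_const.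
apply: mean_le_sum => i.
have mi : measurable_fun setT (fun w => (W t w - W s w) 0 i).
  apply: (measurable_wiener_increment _ wW) => //.
  by rewrite (le_trans s_ge0)// ltW.
split; first exact: measurable_funX.
  by move=> w; rewrite exprM exprn_ge0// sqr_ge0.
rewrite -{1}(sqr_sqrtr (ltW ts0)) -exprM.
apply: normal_moment_le => //; first by rewrite sqrtr_gt0.
by move=> A mA; exact: wiener_increment_coord.
Qed.

(** Summing the coordinates exactly keeps this linear in d, whereas [wiener_enorm_moment] with m = 1
    gives d^2. The running cost depends on it. *)
Lemma wiener_enorm_sqr_moment :
  mean_le P (fun w => enorm (W t w - W s w) ^+ 2)
    (d%:R * (normal_moment_cst R 1 * (t - s))).
Proof.
under eq_fun do rewrite sqr_enorm.
by have := wiener_coord_moment 1; rewrite expr1.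
Qed.

Lemma wiener_enorm_moment (m : nat) : (0 < d)%N ->
  mean_le P (fun w => enorm (W t w - W s w) ^+ (2 * m))
    (d%:R ^+ m * (d%:R * (normal_moment_cst R m * (t - s) ^+ m))).
Proof.
move=> d0; apply: (@mean_le_dom _ _ _ _ _ (fun w => d%:R ^+ m *
    \sum_(i < d) (W t w - W s w) 0 i ^+ (2 * m))).
- apply: measurable_funX; apply: measurable_enorm => i.
  apply: (measurable_wiener_increment _ wW) => //.
  by rewrite (le_trans s_ge0)// ltW.
- by move=> w; rewrite exprn_ge0 ?enorm_ge0//= enorm_expr_le.
- by apply: mean_leZ; [rewrite exprn_ge0|exact: wiener_coord_moment].
Qed.

End wiener_moments.

(** * The dyadic control: state, admissibility and running cost *)

Definition dyadic_time (R : realType) (k : nat) : R := 1 - 2 ^- k.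

Section dyadic_time_theory.
Variable R : realType.
Local Notation tau := (dyadic_time R).

Lemma dyadic_timeB (k : nat) : tau k.+1 - tau k = 2 ^- k.+1.
Proof.
by rewrite /dyadic_time exprS invfM; move: (2 ^+ k)^-1 => z; lra.
Qed.

Lemma dyadic_time0 : tau 0 = 0.
Proof. by rewrite /dyadic_time expr0 invr1 subrr. Qed.

Lemma dyadic_time_lt1 (k : nat) : tau k < 1.
Proof. by rewrite /dyadic_time gtrBl invr_gt0 exprn_gt0. Qed.

Lemma dyadic_time_ltS (k : nat) : tau k < tau k.+1.
Proof. by rewrite -subr_gt0 dyadic_timeB invr_gt0 exprn_gt0. Qed.

Lemma dyadic_time_homo : {homo tau : i j / (i <= j)%N >-> i <= j}.
Proof. by apply/nondecreasing_seqP => k; exact/ltW/dyadic_time_ltS. Qed.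

Lemma dyadic_time_ge0 (k : nat) : 0 <= tau k.
Proof. by rewrite -dyadic_time0 dyadic_time_homo. Qed.

End dyadic_time_theory.

(* On [tau k, tau (k+1)[ the control cancels the displacement from xi observed
   at time tau k, so that X_(tau (k+1)) - xi is the Wiener increment over that
   interval. The case k = 0 includes W 0, which vanishes only almost surely. *)
Definition dyadic_shift (R : realType) (T : Type) (d : nat)
    (x0 : T -> 'rV[R]_d) (W : R -> T -> 'rV[R]_d) (xi : 'rV[R]_d) (k : nat)
    (w : T) : 'rV[R]_d :=
  if k is j.+1 then W (dyadic_time R j) w - W (dyadic_time R k) w
  else xi - x0 w - W (dyadic_time R 0) w.

(** The k-th interval has length 2^-(k+1), so the speed is 2^(k+1) times the shift. The last of the
    n+1 intervals ends at time [dyadic_time R n.+1], after which the control is zero; its shift was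
    observed at [dyadic_time R n]. *)
Definition dyadic_control (R : realType) (T : Type) (d : nat)
    (x0 : T -> 'rV[R]_d) (W : R -> T -> 'rV[R]_d) (xi : 'rV[R]_d) (n : nat)
    (t : R) (w : T) : 'rV[R]_d :=
  step_process (dyadic_time R) n.+1
    (fun k => 2 ^+ k.+1 *: dyadic_shift x0 W xi k w) t.

Section dyadic_control_theory.
Variables (R : realType) (disp : measure_display) (T : measurableType disp).
Variables (P : probability T R) (d : nat) (x0 : T -> 'rV[R]_d).
Variables (W : R -> T -> 'rV[R]_d) (xi : 'rV[R]_d) (n : nat).
Local Notation tau := (dyadic_time R).
Local Notation B := (dyadic_shift x0 W xi).
Local Notation theta := (dyadic_control x0 W xi n).

Lemma sum_dyadic_shift (w : T) :
  \sum_(k < n.+1) B k w = xi - x0 w - W (tau n) w.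
Proof.
elim: n => [|m ih]; first by rewrite big_ord1.
by rewrite big_ord_recr/= ih addrA subrK.
Qed.

(** Applied with [phi] a coordinate, the norm and the squared norm, for the state, admissibility and
    the running cost respectively. *)
Lemma integral_dyadic_control (phi : 'rV[R]_d -> R) (w : T) : phi 0 = 0 ->
  (\int[lebesgue_measure]_(t in `[0%R, 1%R]) (phi (theta t w))%:E =
   (\sum_(k < n.+1) 2 ^- k.+1 * phi (2 ^+ k.+1 *: B k w))%:E)%E.
Proof.
move=> phi0.
under eq_integral do rewrite (step_process_comp _ (@dyadic_time_homo R))//.
rewrite (integral_step (@dyadic_time_homo R) (dyadic_time_ge0 R 0)
  (ltW (dyadic_time_lt1 R n.+1)) (fun k => phi (2 ^+ k.+1 *: B k w))).
by congr EFin; apply: eq_bigr => k _; rewrite dyadic_timeB.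
Qed.

(** The shifts telescope. The identity holds on every path, because the zeroth shift also cancels
    [W 0]. *)
Lemma state_dyadic_control (w : T) :
  state x0 W theta 1 w = xi + (W 1 w - W (tau n) w).
Proof.
apply/rowP => i; rewrite /state !mxE /Rintegral.
rewrite (@integral_dyadic_control (fun x => x 0 i)) ?mxE//=.
under eq_bigr do rewrite mxE mulrA mulVf ?mul1r ?expf_neq0//.
by rewrite -summxE sum_dyadic_shift !mxE; ring.
Qed.

Lemma integral_enorm_dyadic_control (w : T) :
  (\int[lebesgue_measure]_(t in `[0%R, 1%R]) (enorm (theta t w))%:E =
   (\sum_(k < n.+1) enorm (B k w))%:E)%E.
Proof.
rewrite integral_dyadic_control ?enorm0//; congr EFin; apply: eq_bigr => k _.
by rewrite enormZ ger0_norm ?exprn_ge0// mulrA mulVf ?mul1r ?expf_neq0.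
Qed.

Lemma integral_enorm_sqr_dyadic_control (w : T) :
  (\int[lebesgue_measure]_(t in `[0%R, 1%R]) (enorm (theta t w) ^+ 2)%:E =
   (\sum_(k < n.+1) 2 ^+ k.+1 * enorm (B k w) ^+ 2)%:E)%E.
Proof.
rewrite (@integral_dyadic_control (fun x => enorm x ^+ 2)) ?enorm0 ?expr0n//.
congr EFin; apply: eq_bigr => k _.
rewrite enormZ ger0_norm ?exprn_ge0//.
have := @expf_neq0 R 2 k.+1; move: (2 ^+ k.+1) => z z0.
by field; exact: z0.
Qed.

Hypotheses (mx0 : coord_preimages x0 `<=` measurable) (wW : is_wiener P W).
Variable M : R.
Hypothesis x0_moment : mean_le P (fun w => enorm (x0 w - xi) ^+ 2) M.

Lemma measurable_dyadic_shift (k : nat) (i : 'I_d) :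
  measurable_fun setT (fun w => B k w 0 i).
Proof.
have mx := (coord_preimages_measurable x0).1 mx0.
have mW t : 0 <= t -> forall i, measurable_fun setT (fun w => W t w 0 i).
  by move=> t0; apply/coord_preimages_measurable; exact: (wiener_measurable wW).
have mWt j := mW _ (dyadic_time_ge0 R j) i.
case: k => [|k] /=; under eq_fun do rewrite !mxE.
  by apply: measurable_funB => //; exact: measurable_funB.
exact: measurable_funB.
Qed.

Lemma dyadic_shift_moment (k : nat) :
  mean_le P (fun w => enorm (B k w) ^+ 2)
    (if k is j.+1 then d%:R * (normal_moment_cst R 1 * 2 ^- j.+1) else M).
Proof.
case: k => [|j] /=; last first.
  have := wiener_enorm_sqr_moment wW (dyadic_time_ge0 R j) (dyadic_time_ltS R j).
  rewrite dyadic_timeB; congr mean_le; apply/funext => w.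
  by rewrite -opprB enormN.
apply: (mean_le_ae _ _ _ x0_moment).
- by apply: measurable_funX; apply: measurable_enorm; exact: (measurable_dyadic_shift 0).
- by move=> w; rewrite exprn_ge0 ?enorm_ge0.
apply: filterS (wiener_start wW) => w W0.
by rewrite dyadic_time0 W0 subr0 -opprB enormN.
Qed.

Lemma admissible_dyadic_control : admissible P x0 W theta.
Proof.
split.
- move=> i; apply: measurable_funTS.
  apply: (measurable_step_process _ _ (A := fun k w => 2 ^+ k.+1 *: B k w)) => k.
  under eq_fun do rewrite mxE.
  by apply: measurable_funM => //; exact: measurable_dyadic_shift.
- move=> t _.
  apply: (adapted_step_process (A := fun k w => 2 ^+ k.+1 *: B k w)) => k G x0G WG.
  pose T' := g_sigma_algebraType G.
  have mG (Y : T -> 'rV[R]_d) : coord_preimages Y `<=` <<s G >> ->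
      forall i, measurable_fun setT (fun w : T' => Y w 0 i).
    exact: (@coord_preimages_measurable R _ T' d Y).1.
  apply: (@coord_preimages_measurable R _ T' d _).2 => i.
  have mx := mG _ x0G i.
  (* The k-th shift reads W only at the dyadic times of index k - 1 and k. *)
  have mW j : (j <= k)%N -> measurable_fun setT (fun w : T' => W (tau j) w 0 i).
    move=> jk; apply: mG; apply: WG.
    by rewrite dyadic_time_ge0 dyadic_time_homo.
  under eq_fun do rewrite mxE; apply: measurable_funM => //.
  case: k WG mW => [|k] _ mW /=; under eq_fun do rewrite !mxE.
    by apply: measurable_funB; [exact: measurable_funB|exact: mW].
  by apply: measurable_funB; exact: mW.
(* The squared time integral is at most (n+1)^2 times the sum of the squared shifts, whose means are
   finite. *)
- under eq_integral do rewrite integral_enorm_dyadic_control -EFin_expe.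
  have := mean_leZ (exprn_ge0 2 (ler0n R n.+1)) (mean_le_sum (fun k : 'I_n.+1 =>
    dyadic_shift_moment k)).
  move=> /(@mean_le_dom _ _ _ _ (fun w => (\sum_(k < n.+1) enorm (B k w)) ^+ 2)).
  case=> [| |_ _ /le_lt_trans]; last by apply; exact: ltry.
    apply: measurable_funX; apply: measurable_sum => k.
    by apply: measurable_enorm; exact: measurable_dyadic_shift.
  move=> w; rewrite sqr_ge0/=; apply: expr_sum_le => // k.
  exact: enorm_ge0.
Qed.

(** For k >= 1 the weight 2^(k+1) meets a shift of variance 2^-k per coordinate, so each of these n
    terms has the same bound, linear in d. *)
Lemma running_cost_dyadic_control :
  mean_le P (fun w => \sum_(k < n.+1) 2 ^+ k.+1 * enorm (B k w) ^+ 2)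
    (2 * M + n%:R * (2 * d%:R * normal_moment_cst R 1)).
Proof.
rewrite [X in mean_le _ _ X](_ : _ = \sum_(k < n.+1) 2 ^+ k.+1 *
   (if k : nat is j.+1 then d%:R * (normal_moment_cst R 1 * 2 ^- j.+1) else M)).
  apply: mean_le_sum => k.
  by apply: mean_leZ; [rewrite exprn_ge0|exact: dyadic_shift_moment].
rewrite big_ord_recl expr1; congr (_ + _).
rewrite mulr_natl -[X in _ *+ X](card_ord n) -sumr_const; apply: eq_bigr => k _.
by rewrite /bump/= exprS; field; rewrite expf_neq0.
Qed.

End dyadic_control_theory.

(** * Number of intervals and terminal excess *)

(** Let y be the sum of the two logarithmic terms: e^(-y/2) is exactly the target. Since 1/2 <=
    e^(-1/2), every n >= y satisfies 2^-n <= e^(-y/2), and the least integer above y is at most 1 +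
    y. *)
Lemma dyadic_resolution (R : realType) (d : nat) (alpha eps : R) :
  (0 < d)%N -> 0 < alpha -> 0 < eps <= 1 ->
  exists n : nat, 2 ^- n <= eps `^ (2 / alpha) / d%:R ^+ 2 /\
    n%:R <= 1 + 4 * ln d%:R + 4 / alpha * ln (1 / eps).
Proof.
move=> d0 a0 /andP[e0 e1]; have dR0 : 0 < d%:R :> R by rewrite ltr0n.
have lnd0 : 0 <= ln d%:R :> R by rewrite ln_ge0// ler1n.
have lne : ln (1 / eps) = - ln eps by rewrite div1r lnV// posrE.
have lne0 : 0 <= ln (1 / eps) by rewrite lne oppr_ge0 ln_le0.
pose y := 4 * ln d%:R + 4 / alpha * ln (1 / eps).
have y0 : 0 <= y.
  by apply: addr_ge0; apply: mulr_ge0 => //; apply: divr_ge0 => //; exact: ltW.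
have /andP[yn ny] := truncn_itv y0.
exists (Num.truncn y).+1; split; last by rewrite -addrA -/y -natr1; lra.
move: (Num.truncn y).+1 ny {yn} => n yn.
have half : 2^-1 <= expR (- 2^-1) :> R by have := @expR_ge1Dx R (- 2^-1); lra.
rewrite -exprVn (@le_trans _ _ (expR (- 2^-1) ^+ n))//.
  by rewrite lerXn2r// ?nnegrE// expR_ge0.
rewrite -expRM_natl (@le_trans _ _ (expR (- (y / 2))))//.
  by rewrite ler_expR; lra.
rewrite le_eqVlt; apply/orP; left; apply/eqP.
rewrite /powR gt_eqF// -[d%:R in RHS]lnK ?posrE// -expRM_natl -expRN -expRD.
by congr expR; rewrite /y lne; field; rewrite gt_eqF.
Qed.

Section excess.
Variables (R : realType) (disp : measure_display) (T : measurableType disp).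
Variables (P : probability T R) (d : nat) (W : R -> T -> 'rV[R]_d).
Variables (G : 'rV[R]_d -> R) (xi : 'rV[R]_d) (p alpha L eps : R) (m n : nat).
Hypotheses (p_gt0 : 0 < p) (L_gt0 : 0 < L) (alpha_gt0 : 0 < alpha).
Hypotheses (alpha_le1 : alpha <= 1) (eps01 : 0 < eps <= 1) (d_gt0 : (0 < d)%N).
Hypotheses (m_gt0 : (0 < m)%N) (pam : p + alpha <= (2 * m)%:R).
Hypothesis wW : is_wiener P W.
Hypothesis hG : forall x y : 'rV[R]_d, `|G x - G y| <=
  L * (1 + enorm x `^ p + enorm y `^ p) * enorm (x - y) `^ alpha.
Hypothesis xi_min : forall x, G xi <= G x.
Hypothesis n_large : 2 ^- n <= eps `^ (2 / alpha) / d%:R ^+ 2.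

(** With Y the last Wiener increment and q = eps^(2/alpha), the excess is at most a constant times
    eps + (eps/q)|Y|^2 + |Y|^(2m). The choice of n makes the mean of each summand O(eps), uniformly
    in d. *)
Lemma terminal_excess :
  mean_le P
    (fun w => G (xi + (W 1 w - W (dyadic_time R n) w)) - G xi)
    (excess_cst p L (enorm xi) *
       (eps * (1 + normal_moment_cst R 1 + normal_moment_cst R m))).
Proof.
have /andP[e0 e1] := eps01.
have nq := n_large; set q := eps `^ (2 / alpha) in nq *.
have q0 : 0 < q by rewrite powR_gt0.
have dR0 : 0 < d%:R :> R by rewrite ltr0n.
have dR1 : 1 <= d%:R :> R by rewrite ler1n.
have K0 : 0 <= excess_cst p L (enorm xi).
  by rewrite mulr_ge0 ?(ltW L_gt0)// !addr_ge0 ?mulr_ge0 ?powR_ge0.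
have t0 := dyadic_time_ge0 R n; have t1 := dyadic_time_lt1 R n.
have tv : 1 - dyadic_time R n = 2 ^- n by rewrite /dyadic_time; ring.
have mY i := measurable_wiener_increment i wW t0 (ler01 : 0 <= 1 :> R).
have mD := wiener_enorm_moment wW t0 t1 m d_gt0.
have m2 := wiener_enorm_sqr_moment wW t0 t1.
rewrite tv in mD m2; set v := 2 ^- n in nq mD m2.
have v0 : 0 <= v by rewrite invr_ge0 exprn_ge0.
have dv : d%:R ^+ 2 * v <= q by rewrite mulrC -ler_pdivlMr// exprn_gt0.
have c1 := normal_moment_cst_ge0 R 1; have cm := normal_moment_cst_ge0 R m.
have S := mean_leZ K0 (mean_leD (mean_leD (mean_le_cst P (ltW e0))
  (mean_leZ (ltW (divr_gt0 e0 q0)) m2)) mD).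
apply: mean_le_trans (mean_le_dom _ _ S).
(* The quadratic term: d v <= d^2 v <= q cancels the denominator. *)
- rewrite ler_wpM2l// !mulrDr mulr1; apply: lerD; first rewrite lerD2l.
    rewrite mulrAC -mulrA ler_wpM2l ?(ltW e0)// ler_pdivrMr//.
    rewrite mulrCA ler_wpM2l// (le_trans _ dv)// expr2 -mulrA ler_peMl//.
    by rewrite mulr_ge0// ltW.
  (* The high moment: d^(m+1) <= d^(2m) as m >= 1, so d^(m+1) v^m <= q^m = eps^(2m/alpha) <= eps,
     because alpha <= 1 <= 2m and eps <= 1. *)
  rewrite [leLHS](_ : _ = normal_moment_cst R m * (d%:R ^+ m.+1 * v ^+ m)).
    rewrite mulrC ler_wpM2r//.
    apply: (@le_trans _ _ ((d%:R ^+ 2 * v) ^+ m)).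
      rewrite exprMn ler_wpM2r ?exprn_ge0// -exprM ler_weXn2l//.
      by rewrite mul2n -addnn -addn1 leq_add2l.
    rewrite (@le_trans _ _ (q ^+ m))//.
      by rewrite lerXn2r ?nnegrE ?mulr_ge0 ?exprn_ge0// ltW.
    rewrite -powR_mulrn ?(ltW q0)// /q -powRrM -[leRHS](powRr1 (ltW e0)).
    apply: ger_powR; first exact/andP.
    rewrite mulrAC ler_pdivlMr// mul1r -natrM (le_trans alpha_le1)// ler1n.
    by rewrite muln_gt0.
  by rewrite exprSr; ring.
- apply: measurable_funB => //; apply: measurable_continuous_rV.
    exact: (hoelder_continuous L_gt0 p_gt0 alpha_gt0 hG).
  by move=> i; under eq_fun do rewrite mxE; exact: measurable_funD.
- move=> w; rewrite subr_ge0 xi_min/=.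
  apply: le_trans (excess_le _ _ p_gt0 L_gt0 alpha_gt0 pam hG) _.
  rewrite ler_wpM2l// lerD2r powR_le_quadratic ?enorm_ge0//.
  by rewrite alpha_gt0 (le_trans alpha_le1)// ler1n.
Qed.

End excess.

(** Uses u^2 <= 1 + u^(2+2p), split at u = 1, to pass to the moment on which C may depend. *)
Lemma sqr_moment_le (R : realType) (disp : measure_display)
    (T : measurableType disp) (P : probability T R) (d : nat)
    (Y : T -> 'rV[R]_d) (p M : R) :
  0 < p -> (forall i, measurable_fun setT (fun w => Y w 0 i)) ->
  ('E_P[fun w => (enorm (Y w) `^ (2 + 2 * p))%R])%E = M%:E ->
  mean_le P (fun w => enorm (Y w) ^+ 2) (1 + M).
Proof.
move=> p0 mY EM; have mE := measurable_enorm mY.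
have SM : mean_le P (fun w => enorm (Y w) `^ (2 + 2 * p)) M.
  split; last by rewrite -EM unlock.
    apply: (measurableT_comp (f := @powR R ^~ (2 + 2 * p))) => //;
      exact: measurable_powR.
  by move=> w; exact: powR_ge0.
apply: mean_le_dom (mean_leD (mean_le_cst P (ler01 : 0 <= 1 :> R)) SM).
  exact: measurable_funX.
move=> w; rewrite exprn_ge0 ?enorm_ge0//=; set u := enorm _.
have u0 : 0 <= u := enorm_ge0 _; have [u1|u1] := leP u 1.
  by rewrite (@le_trans _ _ 1)// ?exprn_ile1// lerDl powR_ge0.
rewrite (@le_trans _ _ (u `^ (2 + 2 * p)))//; last by rewrite lerDr.
by rewrite -powR_mulrn// ler_powR ?(ltW u1)// lerDl mulr_ge0// ltW.
Qed.

Unset Implicit Arguments.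

(* The quantification of C before everything but p, alpha, L, the moment M of
   x0 - xi and the norm r of xi expresses what C may depend on. *)
Theorem theorem2p2 (R : realType) (p alpha L M r : R)
    (p_gt0 : 0 < p) (L_gt0 : 0 < L) (alpha_gt0 : 0 < alpha)
    (alpha_le1 : alpha <= 1) :
  exists C : R, 0 < C /\
  forall (d : nat) (disp : measure_display) (T : measurableType disp)
    (P : probability T R) (x0 : T -> 'rV[R]_d) (W : R -> T -> 'rV[R]_d)
    (G : 'rV[R]_d -> R) (xi : 'rV[R]_d),
  (0 < d)%N ->
  measure_is_complete P ->
  coord_preimages x0 `<=` measurable ->
  is_wiener P W ->
  independent_systems P (sigma_rv x0) (sigma_process `[0, +oo[ W) ->
  (forall x y : 'rV[R]_d,
     `|G x - G y| <=
     L * (1 + enorm x `^ p + enorm y `^ p) * enorm (x - y) `^ alpha) ->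
  ('E_P[fun w => (enorm (x0 w) `^ (2 * p + 2))%R] < +oo)%E ->
  (forall x : 'rV[R]_d, G xi <= G x) ->
  ('E_P[fun w => (enorm (x0 w - xi) `^ (2 + 2 * p))%R])%E = M%:E ->
  enorm xi = r ->
  forall eps : R, 0 < eps < expR (- 1) ->
  exists theta : R -> T -> 'rV[R]_d,
    admissible P x0 W theta /\
    (0 <= cost P G x0 W eps theta - (G xi)%:E
       <= (C * eps * (d%:R * ln d%:R + d%:R * ln (1 / eps)))%:E)%E.
Proof.
(* A positive integer with p + alpha <= 2m, fixed by p and alpha alone, so that [cm] is an
   admissible part of C. *)
pose m := (Num.truncn (p + alpha)).+1.
have pam : p + alpha <= (2 * m)%:R.
  have pa0 : 0 <= p + alpha by rewrite addr_ge0 ?ltW.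
  have /andP[_ /ltW H] := truncn_itv pa0.
  by rewrite (le_trans H)// ler_nat leq_pmull.
pose c1 := normal_moment_cst R 1; pose cm := normal_moment_cst R m.
pose K := excess_cst p L r.
(* The summands pay for the terminal excess, the first interval and the n later ones. In 5 +
   4/alpha, the numbers 4 and 4/alpha come from the bound on n, and one more unit absorbs its
   additive 1. The absolute value keeps C positive for every real M. *)
pose C := K * (1 + c1 + cm) + (1 + `|M|) + c1 * (5 + 4 / alpha).
have c10 : 0 <= c1 := normal_moment_cst_ge0 R 1.
have cm0 : 0 <= cm := normal_moment_cst_ge0 R m.
have K0 : 0 <= K by rewrite mulr_ge0 ?(ltW L_gt0)// !addr_ge0 ?mulr_ge0 ?powR_ge0.
have a40 : 0 <= 4 / alpha by rewrite divr_ge0// ltW.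
have C1 : 0 <= K * (1 + c1 + cm) by rewrite mulr_ge0// !addr_ge0.
have C2 : 0 <= c1 * (5 + 4 / alpha) by rewrite mulr_ge0// addr_ge0.
exists C; split; first by rewrite /C; have := normr_ge0 M; lra.
move=> d disp T P x0 W G xi d0 _ mx0 wW _ hG _ xi_min EM xir eps /andP[e0 e1].
have elt1 : eps < 1 by rewrite (lt_trans e1)// expR_lt1; lra.
have eps01 : 0 < eps <= 1 by rewrite e0 ltW.
(* Here eps < 1/e enters: terms without a logarithm are absorbed by ln(1/eps), even when d = 1 and
   ln d = 0. *)
have l1 : 1 <= ln (1 / eps).
  rewrite -ler_expR lnK ?posrE ?divr_gt0// div1r.
  by rewrite -lef_pV2 ?posrE ?expR_gt0 ?invr_gt0// invrK -expRN ltW.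
have [n [n_large n_le]] := dyadic_resolution d0 alpha_gt0 eps01.
exists (dyadic_control x0 W xi n).
have mY i : measurable_fun setT (fun w => (x0 w - xi) 0 i).
  under eq_fun do rewrite !mxE; apply: measurable_funB => //.
  by have /coord_preimages_measurable := mx0; apply.
have Mx := sqr_moment_le p_gt0 mY EM.
split; first exact: (admissible_dyadic_control n mx0 wW Mx).
have S1 := terminal_excess p_gt0 L_gt0 alpha_gt0 alpha_le1 eps01 d0
  (ltn0Sn _ : (0 < m)%N) pam wW hG xi_min n_large.
have S2 := running_cost_dyadic_control n mx0 wW Mx.
have e20 : 0 <= eps / 2 by rewrite divr_ge0// ltW.
have S := mean_leD S1 (mean_leZ e20 S2).
have lnd0 : 0 <= ln d%:R :> R by rewrite ln_ge0// ler1n.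
have dR1 : 1 <= d%:R :> R by rewrite ler1n.
(* Pathwise, the integrand is [G xi] plus the nonnegative function whose mean is bounded in [S]. *)
rewrite /cost; under eq_integral => w _.
  rewrite state_dyadic_control integral_enorm_sqr_dyadic_control -EFinM -EFinD.
  rewrite -[X in (X + _)%R](subrK (G xi)) (addrC _ (G xi)) -addrA.
  over.
apply: integral_shift_mean_le; apply: mean_le_trans S.
rewrite xir -/K -/c1 -/cm.
rewrite [leLHS](_ : _ = eps * (K * (1 + c1 + cm) + (1 + M) +
  c1 * (d%:R * n%:R))); last by field.
set D := d%:R * ln d%:R + d%:R * ln (1 / eps).
rewrite [leRHS](_ : _ = eps * (C * D)); last by ring.
rewrite ler_pM2l//.
have dl1 : 1 <= d%:R * ln (1 / eps).
  by rewrite (le_trans l1)// ler_peMl// (le_trans _ l1).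
have dd0 : 0 <= d%:R * ln d%:R :> R by rewrite mulr_ge0.
have D1 : 1 <= D by rewrite /D; lra.
rewrite [leRHS](_ : _ = K * (1 + c1 + cm) * D + (1 + `|M|) * D +
  c1 * (5 + 4 / alpha) * D); last by rewrite /C; ring.
apply: lerD; first apply: lerD.
- by rewrite ler_peMr.
- by have := normr_ge0 M; have := ler_norm M; nra.
rewrite -mulrA ler_wpM2l//.
apply: (@le_trans _ _ (d%:R * (1 + 4 * ln d%:R + 4 / alpha * ln (1 / eps)))).
  by rewrite ler_wpM2l.
have H : 0 <= 4 / alpha * (d%:R * ln d%:R) by rewrite mulr_ge0.
have H2 : d%:R <= d%:R * ln (1 / eps) by rewrite ler_peMr.
by rewrite /D; lra.
Qed.
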